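(* Let $H$ be a group acting on a set $X$ and let $Z$ be any non-trivial group. Then the action $H\curvearrowright Z^{(X)}\smallsetminus\{1\}$ is amenable if and only if $H\curvearrowright X$ is amenable. If it is the case, $H$ is inner amenable relative to the restricted wreath product $G=Z\wr_X H$. Suppose moreover that $X$ is infinite. Then the condition $$\{hgh^{-1}:h\in H\}\ \text{ is infinite for every } g\in G\smallsetminus H$$ holds if and only if all orbits of $H$ on $X$ are infinite.
   Context: Groups are discrete. An action of a group on a set $Y$ is amenable if there exists an invariant state on $\ell^\infty(Y)$ (equivalently, an invariant mean on all subsets of $Y$). $Z^{(X)}$ is the group (under pointwise multiplication) of all functions $a:X\to Z$ such that $\{x\in X:a(x)\neq 1\}$ is finite. $H$ acts on $Z^{(X)}$, and on $Z^{(X)}\smallsetminus\{1\}$, by Bernoulli shift: $\sigma_g(a)(x)=a(g^{-1}x)$. The restricted wreath product is $Z\wr_X H=Z^{(X)}\rtimes_\sigma H$, i.e. $Z^{(X)}\times H$ with $(a_1,g_1)(a_2,g_2)=(a_1\sigma_{g_1}(a_2),g_1g_2)$; $H$ is identified with $\{1\}\times H$. For a pair of groups $H\subset G$, $H$ is inner amenable relative to $G$ if $H$ is a proper subgroup of $G$ and there is a state on $\ell^\infty(G\smallsetminus H)$ invariant under the conjugation action of $H$ on $G\smallsetminus H$. *)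

(* Defs.v *)
From HB Require Import structures.
From mathcomp Require Import all_boot all_order all_algebra.
From mathcomp Require Import complex.
From mathcomp Require Import all_classical all_reals all_analysis.

Set Implicit Arguments.
Unset Strict Implicit.
Unset Printing Implicit Defensive.

Import Order.TTheory GRing.Theory Num.Theory numFieldNormedType.Exports.
Local Open Scope classical_set_scope.
Local Open Scope complex_scope.
Local Open Scope ring_scope.

(* The actions of fingroup/action.v are restricted to finite groups. *)
Record gaction (H : groupType) (Y : Type) := GAction {
  act :> H -> Y -> Y;
  act1 : forall y, act 1%g y = y;
  actM : forall g h y, act (g * h)%g y = act g (act h y) }.

Section RestrictedAction.
Context (H : groupType) (Y : Type) (a : gaction H Y) (A : set Y).
Hypothesis stableA : forall h y, A y -> A (a h y).

Definition restr_act (h : H) (y : A) : A :=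
  exist _ (a h (val y)) (mem_set (stableA h (set_mem (valP y)))).

Fact restr_act1 y : restr_act 1%g y = y.
Proof. by apply: val_inj; rewrite /= act1. Qed.

Fact restr_actM g h y : restr_act (g * h)%g y = restr_act g (restr_act h y).
Proof. by apply: val_inj; rewrite /= actM. Qed.

Definition restr_gaction : gaction H A := GAction restr_act1 restr_actM.

End RestrictedAction.

(* States are functionals on l^oo(Y) with complex values; a functional is given
   as a total function on Y -> R[i], of which only the values on bounded
   functions matter. In R[i], 0 <= z means that z is real and nonnegative. *)
Section States.
Context (R : realType) (Y : Type).

Definition linfty (f : Y -> R[i]) : Prop := bounded_fun (f : Y -> R[i]^o).

Record is_state (phi : (Y -> R[i]) -> R[i]) : Prop := IsState {
  state_linear : forall (c : R[i]) f g, linfty f -> linfty g ->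
    phi (fun y => c * f y + g y) = c * phi f + phi g;
  state_ge0 : forall f, linfty f -> (forall y, 0 <= f y) -> 0 <= phi f;
  state1 : phi (fun=> 1) = 1 }.

Definition state_invariant (I : Type) (t : I -> Y -> Y)
    (phi : (Y -> R[i]) -> R[i]) : Prop :=
  forall i f, linfty f -> phi (f \o t i) = phi f.

End States.

Definition amenable (R : realType) (H : groupType) (Y : Type)
    (a : gaction H Y) : Prop :=
  exists2 phi : (Y -> R[i]) -> R[i], is_state phi & state_invariant a phi.

Record subgroup (G : groupType) := Subgroup {
  subgroup_set :> set G;
  subgroup1 : subgroup_set 1%g;
  subgroupM : forall g h,
    subgroup_set g -> subgroup_set h -> subgroup_set (g * h)%g;
  subgroupV : forall g, subgroup_set g -> subgroup_set g^-1%g }.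

Section InnerAmenable.
Context (G : groupType) (K : subgroup G).

Fact conj_compl_subproof (h : K) (g : ~` K) :
  (val h * val g * (val h)^-1)%g \in ~` K.
Proof.
have Kh := set_mem (valP h); have Kg := set_mem (valP g).
apply/mem_set => Khg; apply: Kg.
have -> : val g = ((val h)^-1 * (val h * val g * (val h)^-1) * val h)%g.
  by rewrite !mulgA mulVg mul1g -mulgA mulVg mulg1.
by apply: subgroupM => //; apply: subgroupM => //; apply: subgroupV.
Qed.

Definition conj_compl (h : K) (g : ~` K) : ~` K :=
  exist _ (val h * val g * (val h)^-1)%g (conj_compl_subproof h g).

Definition inner_amenable (R : realType) : Prop :=
  K `<` [set: G] /\
  exists2 phi : ((~` K) -> R[i]) -> R[i], is_state phi & state_invariant conj_compl phi.

End InnerAmenable.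

(* The group Z^(X) of finitely supported functions X -> Z. *)
Section FinitelySupported.
Context (X : Type) (Z : groupType).

Record fsupp := Fsupp {
  fsupp_fun :> X -> Z;
  fsuppP : finite_set [set x | fsupp_fun x != 1%g] }.

HB.instance Definition _ := gen_eqMixin fsupp.
HB.instance Definition _ := gen_choiceMixin fsupp.

Lemma fsupp_ext (a b : fsupp) : a =1 b -> a = b.
Proof.
case: a b => [a aP] [b bP] /= /funext ab.
by case: _ / ab bP => bP; congr Fsupp; exact: Prop_irrelevance.
Qed.

Fact fsupp_one_subproof : finite_set [set x : X | (1%g : Z) != 1%g].
Proof. by apply: (sub_finite_set _ (finite_set0 X)) => x /=; rewrite eqxx. Qed.

Fact fsupp_inv_subproof (a : fsupp) : finite_set [set x | (a x)^-1%g != 1%g].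
Proof.
apply: sub_finite_set (fsuppP a) => x /=.
by apply: contra => /eqP ->; rewrite invg1.
Qed.

Fact fsupp_mul_subproof (a b : fsupp) :
  finite_set [set x | (a x * b x)%g != 1%g].
Proof.
have fab : finite_set ([set x | a x != 1%g] `|` [set x | b x != 1%g]).
  by rewrite finite_setU; split; exact: fsuppP.
apply: sub_finite_set fab => x /=.
by case: (eqVneq (a x) 1%g) => [->|_ _]; [rewrite mul1g; right | left].
Qed.

Definition fsupp_one := Fsupp fsupp_one_subproof.
Definition fsupp_inv a := Fsupp (fsupp_inv_subproof a).
Definition fsupp_mul a b := Fsupp (fsupp_mul_subproof a b).

Fact fsupp_mulA : associative fsupp_mul.
Proof. by move=> a b c; apply: fsupp_ext => x; exact: mulgA. Qed.
Fact fsupp_mul1 : left_id fsupp_one fsupp_mul.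
Proof. by move=> a; apply: fsupp_ext => x; exact: mul1g. Qed.
Fact fsupp_mulr1 : right_id fsupp_one fsupp_mul.
Proof. by move=> a; apply: fsupp_ext => x; exact: mulg1. Qed.
Fact fsupp_mulV : left_inverse fsupp_one fsupp_inv fsupp_mul.
Proof. by move=> a; apply: fsupp_ext => x; exact: mulVg. Qed.
Fact fsupp_mulrV : right_inverse fsupp_one fsupp_inv fsupp_mul.
Proof. by move=> a; apply: fsupp_ext => x; exact: mulgV. Qed.

HB.instance Definition _ := isGroup.Build fsupp
  fsupp_mulA fsupp_mul1 fsupp_mulr1 fsupp_mulV fsupp_mulrV.

End FinitelySupported.

(* The action s is a parameter of the carrier because the group structure
   declared on it below depends on s. *)
Record wreath (H : groupType) (X : Type) (Z : groupType)
  (s : gaction H X) := Wreath { wr_base : fsupp X Z; wr_top : H }.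

Section WreathProduct.
Context (H : groupType) (X : Type) (Z : groupType) (s : gaction H X).

Fact bshift_subproof (g : H) (a : fsupp X Z) :
  finite_set [set x | a (s g^-1%g x) != 1%g].
Proof.
apply: (sub_finite_set _ (finite_image (s g) (fsuppP a))) => x /= ax.
by exists (s g^-1%g x) => //; rewrite -actM mulgV act1.
Qed.

Definition bshift g a : fsupp X Z := Fsupp (bshift_subproof g a).

Fact bshift1 a : bshift 1%g a = a.
Proof. by apply: fsupp_ext => x; rewrite /= invg1 act1. Qed.

Fact bshiftM g h a : bshift (g * h)%g a = bshift g (bshift h a).
Proof. by apply: fsupp_ext => x; rewrite /= invgM actM. Qed.

Definition bernoulli_action : gaction H (fsupp X Z) := GAction bshift1 bshiftM.

Fact bernoulli_stable g (a : fsupp X Z) :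
  [set~ 1%g] a -> [set~ 1%g] (bernoulli_action g a).
Proof.
move=> /= a1 sa; apply: a1; rewrite -(act1 bernoulli_action a) -(mulVg g) actM.
by have -> : bernoulli_action g a = 1%g := sa; exact: fsupp_ext.
Qed.

Definition bernoulli_nontriv : gaction H [set~ (1%g : fsupp X Z)] :=
  restr_gaction bernoulli_stable.

Local Notation W := (wreath Z s).
Local Notation Wreath := (@Wreath H X Z s).

HB.instance Definition _ := gen_eqMixin W.
HB.instance Definition _ := gen_choiceMixin W.

Definition wreath_one := Wreath 1%g 1%g.
Definition wreath_inv (u : W) :=
  Wreath (bshift (wr_top u)^-1%g (wr_base u)^-1%g) (wr_top u)^-1%g.
Definition wreath_mul (u v : W) :=
  Wreath (wr_base u * bshift (wr_top u) (wr_base v))%g (wr_top u * wr_top v)%g.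

Fact bshift_mul g a b : bshift g (a * b)%g = (bshift g a * bshift g b)%g.
Proof. exact: fsupp_ext. Qed.
Fact bshift_one g : bshift g 1%g = 1%g.
Proof. exact: fsupp_ext. Qed.

Fact wreath_mulA : associative wreath_mul.
Proof.
move=> [a g] [b h] [c k]; rewrite /wreath_mul /=.
by rewrite bshift_mul bshiftM !mulgA.
Qed.
Fact wreath_mul1 : left_id wreath_one wreath_mul.
Proof. by move=> [a g]; rewrite /wreath_mul /= bshift1 !mul1g. Qed.
Fact wreath_mulr1 : right_id wreath_one wreath_mul.
Proof. by move=> [a g]; rewrite /wreath_mul /= bshift_one !mulg1. Qed.
Fact wreath_mulV : left_inverse wreath_one wreath_inv wreath_mul.
Proof.
by move=> [a g]; rewrite /wreath_mul /= -bshift_mul !mulVg bshift_one.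
Qed.
Fact wreath_mulrV : right_inverse wreath_one wreath_inv wreath_mul.
Proof.
by move=> [a g]; rewrite /wreath_mul /= -bshiftM !mulgV bshift1 mulgV.
Qed.

HB.instance Definition _ := isGroup.Build W
  wreath_mulA wreath_mul1 wreath_mulr1 wreath_mulV wreath_mulrV.

(* The copy {1} x H of H in the wreath product. *)
Definition wreath_top_set : set W := range (Wreath 1%g).

Fact wreath_top1 : wreath_top_set 1%g.
Proof. by exists 1%g. Qed.
Fact wreath_topM (u v : W) :
  wreath_top_set u -> wreath_top_set v -> wreath_top_set (u * v)%g.
Proof.
move=> [g _ <-] [h _ <-]; exists (g * h)%g => //.
by change (Wreath 1%g (g * h)%g = wreath_mul (Wreath 1%g g) (Wreath 1%g h));
  rewrite /wreath_mul /= bshift_one mulg1.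
Qed.
Fact wreath_topV (u : W) : wreath_top_set u -> wreath_top_set u^-1%g.
Proof.
move=> [g _ <-]; exists g^-1%g => //.
by change (Wreath 1%g g^-1%g = wreath_inv (Wreath 1%g g));
  rewrite /wreath_inv /= invg1 bshift_one.
Qed.

Definition wreath_top : subgroup W :=
  Subgroup wreath_top1 wreath_topM wreath_topV.

End WreathProduct.

Arguments amenable R {H Y} a.
Arguments inner_amenable {G} K R.
Arguments bernoulli_nontriv {H X} Z s.
Arguments wreath {H X} Z s.
Arguments wreath_top {H X} Z s.

(* Main.v *)
Require Import Defs.
From mathcomp Require Import all_boot all_order all_algebra finmap complex.
From mathcomp Require Import all_classical all_reals all_analysis.

Local Open Scope classical_set_scope.
Local Open Scope group_scope.

(** Everything is carried by three equivariant maps.  A fixed [z <> 1] gives the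
    point masses [delta z x], i.e. equivariant maps from [X] to the nontrivial
    elements of [Z^(X)] and, as [(delta z x, 1)], to the complement of [H] in
    the wreath product with its conjugation action; pushing an invariant state
    forward along them settles amenability of the Bernoulli shift and relative
    inner amenability.  In the other direction, a nontrivial [a] is sent to the
    uniform probability on its finite nonempty support, so a bounded function
    on [X] can be averaged over supports into a bounded function on
    [Z^(X) \ {1}], and an invariant state there yields one on [X].  The common
    mechanism is that invariant states pull back along equivariant Markov
    operators ([markov_state], [markov_invariant]).

    For the conjugacy classes, [h (a, k) h^-1 = (h a, h k h^-1)].  If the orbit
    of [x] is finite, so is the class of [(delta z x, 1)].  Conversely, if
    [(a, k)] has a finite class, then [a] has finitely many translates; their
    supports have a finite union, which contains the orbit of each [x] in the
    support of [a]. *)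

(** * Transport of invariant states *)

Section MarkovOperators.
Import Order.TTheory GRing.Theory Num.Theory.
Local Open Scope ring_scope.
Context {R : realType}.
Local Notation C := (R[i])%C.

(** Contraction does follow from the other clauses, but for complex functions
    only after rotating each value [T f y'] to the real axis; for averages it is
    just the triangle inequality, so it is taken as a clause. *)
Record markov {Y Y' : Type} (T : (Y -> C) -> Y' -> C) : Prop := Markov {
  markov_linear : forall c f g,
    T (fun y => c * f y + g y) = fun y' => c * T f y' + T g y';
  markov_ge0 : forall f, (forall y, 0 <= f y) -> forall y', 0 <= T f y';
  markov1 : T (fun=> 1) = fun=> 1;
  markov_contract : forall f M,
    (forall y, `|f y| <= M) -> forall y', `|T f y'| <= M }.

Lemma linftyP {Y : Type} (f : Y -> C) :
  linfty f <-> exists M : C, forall y, `|f y| <= M.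
Proof.
split=> [[M [Mreal fM]]|[M fM]].
  by exists (M + 1) => y; apply: (fM (M + 1)) => //; rewrite ltrDl ltr01.
case: (pselect (inhabited Y)) => [[y0]|Y0]; last first.
  by exists 0; split=> [|N _ y _]; [exact: rpred0 | case: Y0].
exists M; split=> [|N MN y _]; last exact: le_trans (fM y) (ltW MN).
exact: ger0_real (le_trans (normr_ge0 _) (fM y0)).
Qed.

Lemma linfty_markov {Y Y' : Type} {T : (Y -> C) -> Y' -> C} (f : Y -> C) :
  markov T -> linfty f -> linfty (T f).
Proof.
by move=> mT /linftyP[M fM]; apply/linftyP; exists M; exact: markov_contract.
Qed.

Lemma markov_state {Y Y' : Type} {T : (Y -> C) -> Y' -> C}
    {phi : (Y' -> C) -> C} :
  markov T -> is_state phi -> is_state (phi \o T).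
Proof.
move=> mT sphi; split=> /= [c f g lf lg|f lf f0|].
- by rewrite (markov_linear _ mT) (state_linear sphi) //; exact: linfty_markov.
- by apply: (state_ge0 sphi); [exact: linfty_markov|exact: markov_ge0].
- by rewrite (markov1 _ mT) (state1 sphi).
Qed.

Lemma markov_invariant {Y Y' I I' : Type} {T : (Y -> C) -> Y' -> C}
    {t : I -> Y -> Y} {t' : I' -> Y' -> Y'} {phi : (Y' -> C) -> C} :
  markov T ->
  (forall i, exists i', forall f, T (f \o t i) = T f \o t' i') ->
  state_invariant t' phi -> state_invariant t (phi \o T).
Proof.
move=> mT equi inv i f lf /=; have [i' Tt] := equi i.
by rewrite Tt inv //; exact: linfty_markov.
Qed.

Lemma markov_comp {Y Y' : Type} (p : Y' -> Y) :
  markov (fun f : Y -> C => f \o p).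
Proof. by split=> // [f f0 y'|f M fM y'] /=. Qed.

Lemma is_state_nonempty {Y : Type} {phi : (Y -> C) -> C} :
  is_state phi -> inhabited Y.
Proof.
move=> sphi; apply/not_notP => Y0.
have triv f g : f = g :> (Y -> C) by apply/funext => y; case: Y0.
have l1 : linfty (fun _ : Y => 1 : C) by apply/linftyP; exists 1 => y; case: Y0.
(* On an empty set [-1 * 1 + 1] and [1] are the same function. *)
have := state_linear sphi (-1) l1 l1.
rewrite (triv (fun y => _) (fun=> 1)) (state1 sphi) mulN1r addNr.
by move/eqP; rewrite oner_eq0.
Qed.

End MarkovOperators.

(** * Averaging over supports *)

Section SupportAverage.
Import Order.TTheory GRing.Theory Num.Theory.
Local Open Scope ring_scope.
Context {R : realType} {H Z : groupType} {X : choiceType} (s : gaction H X).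
Local Notation C := (R[i])%C.
Local Notation B := [set~ (1%g : fsupp X Z)].

Definition supp (a : fsupp X Z) : set X := [set x | a x != 1%g].

Definition mass (a : fsupp X Z) (f : X -> C) : C := \sum_(x \in supp a) f x.

(** The size of the support is taken as the mass of the constant 1, so that a
    single reindexing gives the equivariance of numerator and denominator. *)
Definition average (f : X -> C) (a : B) : C :=
  mass (val a) f / mass (val a) (fun=> 1).

Lemma massE a f : mass a f = \sum_(x <- fset_set (supp a)) f x.
Proof. by rewrite /mass fsbig_finite //; exact: fsuppP. Qed.

Lemma supp_bshift h a : set_bij (supp a) (supp (bshift s h a)) (s h).
Proof.
split=> [x|x y _ _ sxy|x].
- by rewrite /supp /= -actM mulVg act1.
- by rewrite -(act1 s x) -(act1 s y) -(mulVg h) !actM sxy.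
- by rewrite /supp /= => ax; exists (s h^-1%g x) => //=; rewrite -actM mulgV act1.
Qed.

Lemma mass_bshift h a f : mass (bshift s h a) f = mass a (f \o s h).
Proof. exact: (reindex_fsbig (s h) _ _ _ (supp_bshift h a)). Qed.

Lemma mass1_gt0 (a : B) : 0 < mass (val a) (fun=> 1).
Proof.
have a1 : val a <> 1%g by exact: set_mem (valP a).
have [x ax] : supp (val a) !=set0.
  apply/set0P/eqP => a0; apply: a1; apply: fsupp_ext => x.
  apply/eqP/negPn/negP => ax.
  by have : supp (val a) x by []; rewrite a0.
have xa : x \in fset_set (supp (val a)).
  by rewrite in_fset_set ?mem_set //; exact: fsuppP.
rewrite massE (big_fsetD1 x) //= ltr_pwDl ?ltr01 //.
by apply: sumr_ge0 => i _; exact: ler01.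
Qed.

Lemma average_markov : markov average.
Proof.
split=> [c f g|f f0 a||f M fM a].
- apply/funext => a; rewrite /average mulrA -mulrDl; congr (_ / _).
  by rewrite !massE big_split /= mulr_sumr.
- rewrite divr_ge0 ?(ltW (mass1_gt0 a)) // massE.
  by apply: sumr_ge0.
- by apply/funext => a; rewrite /average divff // gt_eqF // mass1_gt0.
- rewrite normrM normfV (gtr0_norm (mass1_gt0 a)).
  rewrite ler_pdivrMr ?mass1_gt0 // !massE mulr_sumr.
  apply: le_trans (ler_norm_sum _ _ _) _.
  by apply: ler_sum => x _; rewrite mulr1.
Qed.

Lemma amenable_of_bernoulli :
  amenable R (bernoulli_nontriv Z s) -> amenable R s.
Proof.
case=> phi sphi inv; exists (phi \o average).
  exact: markov_state average_markov sphi.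
apply: markov_invariant average_markov _ inv => h; exists h => f.
by apply/funext => a; rewrite /average /= !mass_bshift.
Qed.

End SupportAverage.

(** * Point masses *)

Section PointMasses.
Context {R : realType} {H Z : groupType} {X : Type} (s : gaction H X).

Lemma delta_subproof (z : Z) (x : X) :
  finite_set [set y | (if `[< y = x >] then z else 1) != 1].
Proof.
apply: sub_finite_set (finite_set1 x) => y /=.
by case: asboolP => //; rewrite eqxx.
Qed.

Definition delta (z : Z) (x : X) : fsupp X Z := Fsupp (delta_subproof z x).

Lemma bshift_delta h z x : bshift s h (delta z x) = delta z (s h x).
Proof.
apply: fsupp_ext => y /=; congr (if _ then _ else _).
apply: asbool_equiv_eq; split=> [<-|->].
  by rewrite -actM mulgV act1.
by rewrite -actM mulVg act1.
Qed.

Context {z : Z} (z1 : z <> 1).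

Lemma delta_neq1 x : delta z x <> 1.
Proof.
move=> /(congr1 (fun a : fsupp X Z => a x)) /=.
by case: asboolP => // _ /z1.
Qed.

Definition delta_nontriv (x : X) : [set~ (1 : fsupp X Z)] :=
  exist _ (delta z x) (mem_set (delta_neq1 x)).

Lemma bernoulli_of_amenable :
  amenable R s -> amenable R (bernoulli_nontriv Z s).
Proof.
case=> phi sphi inv; have mT := markov_comp (R := R) delta_nontriv.
exists (phi \o (fun f => f \o delta_nontriv)); first exact: markov_state.
apply: (markov_invariant mT _ inv) => h; exists h => f.
apply/funext => x /=; congr f; apply: val_inj => /=.
exact: bshift_delta.
Qed.

Lemma wreath_topP (u : wreath Z s) :
  (wreath_top Z s : set (wreath Z s)) u <-> wr_base u = 1.
Proof. by split=> [[g _ <-]//|]; case: u => a g /= ->; exists g. Qed.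

Lemma wreath_conj (h k : H) (a : fsupp X Z) :
  (Wreath s 1 h : wreath Z s) * Wreath s a k * (Wreath s 1 h)^-1 =
  Wreath s (bshift s h a) (h * k * h^-1) :> wreath Z s.
Proof.
transitivity
  (wreath_mul (wreath_mul (Wreath s 1 h) (Wreath s a k))
     (wreath_inv (Wreath s 1 h)) : wreath Z s) => //.
by rewrite /wreath_mul /wreath_inv /= invg1 !bshift_one mulg1 mul1g.
Qed.

Lemma delta_notin_top x : (~` wreath_top Z s) (Wreath s (delta z x) 1).
Proof. by move/wreath_topP; exact: delta_neq1. Qed.

Definition delta_wreath (x : X) : ~` wreath_top Z s :=
  exist _ (Wreath s (delta z x) 1) (mem_set (delta_notin_top x)).

Lemma wreath_inner_amenable : amenable R s -> inner_amenable (wreath_top Z s) R.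
Proof.
case=> phi sphi inv; split.
  have [x] := is_state_nonempty sphi.
  by split=> // topT; apply: (delta_notin_top x); exact: topT.
have mT := markov_comp (R := R) delta_wreath.
exists (phi \o (fun f => f \o delta_wreath)); first exact: markov_state.
apply: (markov_invariant mT _ inv) => -[u uH]; have [h _ hu] := set_mem uH.
exists h => f; apply/funext => x /=; congr f; apply: val_inj => /=.
by rewrite -hu wreath_conj bshift_delta mulg1 mulgV.
Qed.

Lemma delta_class_finite x :
  finite_set [set s h x | h in [set: H]] ->
  finite_set [set h * Wreath s (delta z x) 1 * h^-1 | h in wreath_top Z s].
Proof.
move/(finite_image (fun y => Wreath s (delta z y) 1)).
apply: sub_finite_set => _ [_ [h _ <-] <-].
exists (s h x); first by exists h.
by rewrite wreath_conj bshift_delta mulg1 mulgV.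
Qed.

(** Any point of the support of the base of [g] has its orbit inside the union
    of the supports of the bases of the conjugates of [g]. *)
Lemma orbit_finite_of_class (g : wreath Z s) (x : X) :
  wr_base g x != 1 ->
  finite_set [set h * g * h^-1 | h in wreath_top Z s] ->
  finite_set [set s h x | h in [set: H]].
Proof.
case: g => a k /= ax fin.
apply: sub_finite_set (bigcup_finite fin (fun u _ => fsuppP (wr_base u))).
move=> _ [h _ <-]; exists (Wreath s 1 h * Wreath s a k * (Wreath s 1 h)^-1).
  by exists (Wreath s 1 h) => //; exists h.
by rewrite wreath_conj /= -actM mulVg act1.
Qed.

End PointMasses.

Lemma wreath_notin_topP {H Z : groupType} {X : Type} (s : gaction H X)
    (g : wreath Z s) :
  (~` wreath_top Z s) g -> exists x, wr_base g x != 1.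
Proof.
move=> gtop; apply/not_existsP => g1; apply: gtop; apply/wreath_topP.
by apply: fsupp_ext => x; apply/eqP/negPn/negP; exact: g1.
Qed.

Theorem theorem3p6 (R : realType) (H Z : groupType) (X : Type)
    (s : gaction H X) (Z_nontrivial : exists z : Z, z <> 1) :
  [/\ amenable R (bernoulli_nontriv Z s) <-> amenable R s,
      amenable R s -> inner_amenable (wreath_top Z s) R
    & infinite_set [set: X] ->
      ((forall g : wreath Z s, (~` wreath_top Z s) g ->
          infinite_set [set h * g * h^-1 | h in wreath_top Z s])
       <->
       (forall x : X, infinite_set [set s h x | h in [set: H]]))].
Proof.
have [z z1] := Z_nontrivial; split.
- split; last exact: bernoulli_of_amenable z1.
  (* Sums over supports are indexed by a type with choice, which [X] gets
     classically. *)
  exact: (@amenable_of_bernoulli R H Z {classic X} s).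
- exact: wreath_inner_amenable z1.
- move=> _; split=> [infC x finO | infO g /wreath_notin_topP[x gx] finC].
    exact: (infC _ (delta_notin_top s z1 x)) (delta_class_finite s x finO).
  exact: (infO x) (orbit_finite_of_class s g x gx finC).
Qed.
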